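(* Let $K$ be a field of characteristic $0$, $n\ge2$, and let $f\in K[[x_1,\dots,x_n]]$ be D-finite over $K(x_1,\dots,x_n)$. For each $i$ fix a non-zero $L_i\in K[x_1,\dots,x_n]\langle D_{x_i}\rangle$ with $L_i(f)=0$, of order $r_i$ and degree $d_i$; let $r_f=\max_ir_i$ and $d_f=\max_id_i$. Let $T=x_1D_{x_1}-x_2D_{x_2}$ and $D_{x_1,x_2}=D_{x_1}D_{x_2}$ in the Weyl algebra. Then there exists a non-zero operator $P$ with $P(f)=0$ lying in the subalgebra $K[x_3,\dots,x_n][x_1x_2]\langle T,D_{x_1,x_2}\rangle$, such that, writing $P=\sum c_{i,j,\ell}(x_3,\dots,x_n)(x_1x_2)^iT^jD_{x_1,x_2}^\ell$ with $c_{i,j,\ell}\in K[x_3,\dots,x_n]$, $P$ has degree $O(d_f^2r_f^2)$ in $x_1x_2$, total degree $O(d_f^9r_f^8)$ in $x_3,\dots,x_n$, and total degree $O(d_f^2r_f^2)$ in $T,D_{x_1,x_2}$; and for each $h\in\{3,\dots,n\}$ there exists a non-zero operator $Q_h$ with $Q_h(f)=0$ lying in $K[x_3,\dots,x_n][x_1x_2]\langle T,D_{x_h}\rangle$, of degree $O(d_f^2r_f^3)$ in $x_1x_2$, total degree $O(d_f^9r_f^{12})$ in $x_3,\dots,x_n$, and total degree $O(d_f^2r_f^3)$ in $T,D_{x_h}$.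
   Context: A series $g\in K[[x_1,\dots,x_n]]$ is D-finite over $K(x_1,\dots,x_n)$ if the $K(x_1,\dots,x_n)$-vector space spanned by all its partial derivatives in $K(x_1,\dots,x_n)\otimes_{K[x_1,\dots,x_n]}K[[x_1,\dots,x_n]]$ is finite-dimensional. The Weyl algebra $W_n=K[x_1,\dots,x_n]\langle D_{x_1},\dots,D_{x_n}\rangle$ has $D_{x_i}a=aD_{x_i}+\partial a/\partial x_i$. For $L=\sum_{j=0}^r\ell_jD_{x_i}^j$ with $\ell_r\ne0$, order is $r$ and degree is the maximal total degree of the $\ell_j$. The subalgebra $K[x_3,\dots,x_n][x_1x_2]\langle T,D_{x_1,x_2}\rangle$ is the $K$-subalgebra of $W_n$ generated by $x_1x_2,x_3,\dots,x_n,T,D_{x_1,x_2}$; its elements $(x_1x_2)^ix_3^{k_3}\cdots x_n^{k_n}T^jD_{x_1,x_2}^\ell$ form a $K$-basis, which gives the degree notions used (similarly for $T,D_{x_h}$). The $O(\cdot)$ bounds are as functions of $d_f$ and $r_f$. *)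

(* Defs.v *)
From HB Require Import structures.
From mathcomp Require Import all_boot all_order all_algebra.
From mathcomp Require Import mpoly.
Set Implicit Arguments. Unset Strict Implicit. Unset Printing Implicit Defensive.
Import Order.TTheory GRing.Theory Num.Theory.
Local Open Scope ring_scope.

(* Formal power series K[[x_1,...,x_n]]: arbitrary coefficient functions on  *)
(* exponent vectors (variables are indexed by 'I_n, x_1 <-> index 0, ...).   *)
Definition series (K : fieldType) (n : nat) := 'X_{1..n} -> K.

Section Series.
Variables (K : fieldType) (n : nat).
Implicit Types (s : series K n) (p : {mpoly K[n]}).

Definition szero : series K n := fun _ => 0.
Definition sadd s1 s2 : series K n := fun m => s1 m + s2 m.
Definition ssub s1 s2 : series K n := fun m => s1 m - s2 m.
Definition ssum (A : Type) (r : seq A) (F : A -> series K n) : series K n :=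
  fun m => \sum_(a <- r) F a m.

Definition smulX (i : 'I_n) s : series K n :=
  fun m => if (0 < m i)%N then s (mnm_sub m (mnm1 i)) else 0.

Definition sder (i : 'I_n) s : series K n :=
  fun m => (m i).+1%:R * s (mnm_add m (mnm1 i)).

Definition spmul p s : series K n :=
  fun m => \sum_(a <- msupp p | lem a m) p@_a * s (mnm_sub m a).

Definition sderm (a : 'X_{1..n}) s : series K n :=
  foldr (fun i t => iter (a i) (sder i) t) s (enum 'I_n).

(* D-finiteness: the K(x)-span of all partial derivatives of f inside       *)
(* K(x) (x)_{K[x]} K[[x]] is finite dimensional.  Written out (K[[x]] is a  *)
(* torsion-free K[x]-module): there is a finite family of derivatives such  *)
(* that every derivative is a K(x)-linear combination of them, i.e. after   *)
(* clearing denominators  q * D^a f = sum_b p_b * D^b f  with q <> 0.       *)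
Definition DFinite (f : series K n) : Prop :=
  exists S : seq 'X_{1..n}, forall a : 'X_{1..n},
    exists2 q : {mpoly K[n]}, q != 0 &
      exists p : 'X_{1..n} -> {mpoly K[n]},
        spmul q (sderm a f) = ssum S (fun b => spmul (p b) (sderm b f)).

(* total degree of a multivariate polynomial (0 for the zero polynomial) *)
Definition tdeg p : nat := \max_(m <- msupp p) mdeg m.

(* ---- operators L = sum_j l_j D_{x_i}^j in K[x_1..x_n]<D_{x_i}> ------------ *)
(* represented by the univariate polynomial sum_j l_j Y^j with coefficients  *)
(* l_j in K[x_1..x_n].                                                        *)
Definition ordop (i : 'I_n) (L : {poly {mpoly K[n]}}) (s : series K n) :
  series K n :=
  ssum (iota 0 (size L)) (fun j => spmul L`_j (iter j (sder i) s)).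

Definition op_order (L : {poly {mpoly K[n]}}) : nat := (size L).-1.
Definition op_degree (L : {poly {mpoly K[n]}}) : nat :=
  \max_(j < size L) tdeg L`_j.

End Series.
Arguments szero K n _ : clear implicits.

Section Sub.
Variables (K : fieldType) (m : nat).
Local Notation n := m.+2.

Definition ix1 : 'I_n := ord0.
Definition ix2 : 'I_n := lift ord0 ord0.

Definition sT (s : series K n) : series K n :=
  ssub (smulX ix1 (sder ix1 s)) (smulX ix2 (sder ix2 s)).

Definition sD12 (s : series K n) : series K n := sder ix1 (sder ix2 s).

Definition free12 (p : {mpoly K[n]}) : bool :=
  all (fun a : 'X_{1..n} => (a ix1 == 0%N) && (a ix2 == 0%N)) (msupp p).

(* Coefficient representation of an element of K[x_3..x_n][x_1x_2]<T, E>:  *)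
(* c : {mpoly {mpoly K[n]}[3]} with every coefficient in K[x_3..x_n]; the *)
(* monomial e = (i, j, l) with coefficient c_e encodes                      *)
(*      c_e(x_3..x_n) (x_1x_2)^i T^j E^l                                    *)
(* (these products form a K-basis of the subalgebra).                       *)
Definition subalg_coeffs (c : {mpoly {mpoly K[n]}[3]}) : bool :=
  all (fun e => free12 c@_e) (msupp c).

Definition e0 : 'I_3 := ord0.
Definition e1 : 'I_3 := inord 1.
Definition e2 : 'I_3 := inord 2.

Definition subalg_act (E : series K n -> series K n)
    (c : {mpoly {mpoly K[n]}[3]}) (s : series K n) : series K n :=
  ssum (msupp c) (fun e =>
    iter (e e0) (fun t => smulX ix1 (smulX ix2 t))
      (spmul c@_e (iter (e e1) sT (iter (e e2) E s)))).

Definition deg_x1x2 (c : {mpoly {mpoly K[n]}[3]}) : nat :=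
  \max_(e <- msupp c) e e0.
Definition deg_params (c : {mpoly {mpoly K[n]}[3]}) : nat :=
  \max_(e <- msupp c) tdeg c@_e.
Definition deg_ops (c : {mpoly {mpoly K[n]}[3]}) : nat :=
  \max_(e <- msupp c) (e e1 + e e2)%N.

End Sub.

(* Main.v *)
Require Import Defs.
From HB Require Import structures.
From mathcomp Require Import all_boot all_order all_algebra.
From mathcomp Require boolp.
From mathcomp Require Import zify ring.
From mathcomp Require Import mpoly.
Set Implicit Arguments. Unset Strict Implicit. Unset Printing Implicit Defensive.
Import Order.TTheory GRing.Theory.
Local Open Scope ring_scope.

(* Multiplied by suitable powers of the leading coefficients of the L_i, every *)
(* derivative of f of order at most M becomes a combination of the r_1 r_2     *)
(* (or r_1 r_2 r_h) derivatives with small exponents, with polynomial          *)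
(* coefficients of degree O(d_f M).  The images of f under (x_1x_2)^i T^j E^l  *)
(* with i < d_f N and j, l < N share one such denominator.  Comparing the      *)
(* coefficients of x_1^u x_2^v turns a relation between them into              *)
(* O(r_f^2 (d_f N)^2) (resp. O(r_f^3 (d_f N)^2)) linear equations over         *)
(* K[x_3..x_n] in d_f N^3 unknowns, so N of order d_f r_f^2 (resp. d_f r_f^3)  *)
(* leaves a nonzero solution, and Cramer's rule bounds its degree.             *)

(** Once the leading coefficients of the [L i] are inverted, all derivatives of [f] in the chosen
    directions lie in the span of those whose exponents stay below the orders of the operators: at
    most R of them, with R about r_f^2 for the pair x_1, x_2 and r_f^3 when x_h is added. An
    annihilator in the subalgebra is a linear dependence among the images of [f], but with scalars
    restricted to K[x_3..x_n]. Splitting polynomial coordinates along x_1^u x_2^v turns each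
    coordinate into quadratically many equations in its degree, so everything rests on keeping that
    degree linear in the order N of the words. This linearity comes from [spanned_denom]: one
    differentiation costs a single further power of the leading coefficient. It leads through
    [spanned_pderiv] to [word_coords], which gives all words one common denominator. For a fixed
    operator bound the unknowns then grow like N^3 and the equations like N^2, so [param_relation]
    finds a dependence, with degrees controlled by the minors of [graded_kernel]. Finally
    [series_torsion_free] cancels the denominator. The count is made once, in [annihilator], for
    both kinds of operators. *)

Lemma big_msupp_widen (n : nat) (R : nzRingType) (V : zmodType)
    (p : {mpoly R[n]}) (r : seq 'X_{1..n}) (F : 'X_{1..n} -> V) :
  uniq r -> {subset msupp p <= r} -> (forall a, p@_a = 0 -> F a = 0) ->
  \sum_(a <- msupp p) F a = \sum_(a <- r) F a.
Proof.
move=> Ur sub F0; rewrite [RHS](bigID (fun a => a \in msupp p)) /= [X in _ + X]big1 ?addr0.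
  rewrite -[RHS]big_filter; apply: perm_big; apply: uniq_perm.
  - exact: msupp_uniq.
  - exact: filter_uniq.
  - by move=> a; rewrite mem_filter; case: (boolP (a \in msupp p)) => //= /sub.
by move=> a aN; apply: F0; apply: memN_msupp_eq0.
Qed.

(** * Total degree of multivariate polynomials *)

Section TotalDegree.
Variables (K : fieldType) (n : nat).
Implicit Types (p q : {mpoly K[n]}) (k l : nat).

Lemma tdeg_leP p k :
  reflect (forall a, a \in msupp p -> mdeg a <= k)%N (tdeg p <= k)%N.
Proof.
apply: (iffP (bigmax_leqP_seq _ _ _ _)) => h a; first by move=> ap; apply: h.
by move=> ap _; apply: h.
Qed.

Lemma tdeg0 : tdeg (0 : {mpoly K[n]}) = 0%N.
Proof. by rewrite /tdeg msupp0 big_nil. Qed.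

Lemma tdegX (a : 'X_{1..n}) : tdeg 'X_[K, a] = mdeg a.
Proof. by rewrite /tdeg msuppX big_seq1. Qed.

Lemma tdeg1 : tdeg (1 : {mpoly K[n]}) = 0%N.
Proof. by rewrite -mpolyX0 tdegX mdeg0. Qed.

Lemma tdegN p : tdeg (- p) = tdeg p.
Proof. by rewrite /tdeg; apply: perm_big; apply: msuppN. Qed.

Lemma tdegD_le p q k : (tdeg p <= k -> tdeg q <= k -> tdeg (p + q) <= k)%N.
Proof.
move=> /tdeg_leP hp /tdeg_leP hq; apply/tdeg_leP => a /msuppD_le.
by rewrite mem_cat => /orP[/hp|/hq].
Qed.

Lemma tdegM_le p q k l :
  (tdeg p <= k -> tdeg q <= l -> tdeg (p * q) <= k + l)%N.
Proof.
move=> /tdeg_leP hp /tdeg_leP hq; apply/tdeg_leP => a /msuppM_le.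
by case/allpairsP => -[b c] /= [/hp hb /hq hc ->]; rewrite mdegD leq_add.
Qed.

Lemma tdegZ_le (c : K) p : (tdeg (c *: p) <= tdeg p)%N.
Proof. by apply/tdeg_leP => a /msuppZ_le; apply/tdeg_leP. Qed.

Lemma tdegXn_le p k e : (tdeg p <= k -> tdeg (p ^+ e) <= e * k)%N.
Proof.
move=> hp; elim: e => [|e IH]; first by rewrite expr0 tdeg1.
by rewrite exprS mulSn; apply: tdegM_le.
Qed.

Lemma tdeg_mderiv i p : (tdeg p^`M(i) <= tdeg p)%N.
Proof.
apply/tdeg_leP => a; rewrite mcoeff_msupp mcoeff_deriv => nz.
have /(tdeg_leP _ _ (leqnn _)) : (a + U_(i))%MM \in msupp p.
  by rewrite mcoeff_msupp; apply: contraNneq nz => ->; rewrite mul0rn.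
by rewrite mdegD; apply: leq_trans; apply: leq_addr.
Qed.

End TotalDegree.

(** * Power series as a torsion-free module over the polynomial ring, with its derivations *)

HB.instance Definition _ (K : fieldType) (n : nat) :=
  boolp.gen_eqMixin (series K n).
HB.instance Definition _ (K : fieldType) (n : nat) :=
  boolp.gen_choiceMixin (series K n).

Section SeriesModule.
Variables (K : fieldType) (n : nat).
Implicit Types (p q : {mpoly K[n]}) (s t : series K n) (a b m : 'X_{1..n}).

Definition sopp s : series K n := fun m => - s m.

Fact saddA : associative (@sadd K n).
Proof. by move=> s t u; apply: boolp.funext => m; apply: addrA. Qed.
Fact saddC : commutative (@sadd K n).
Proof. by move=> s t; apply: boolp.funext => m; apply: addrC. Qed.
Fact sadd0 : left_id (szero K n) (@sadd K n).
Proof. by move=> s; apply: boolp.funext => m; apply: add0r. Qed.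
Fact saddN : left_inverse (szero K n) sopp (@sadd K n).
Proof. by move=> s; apply: boolp.funext => m; apply: addNr. Qed.

HB.instance Definition _ :=
  GRing.isZmodule.Build (series K n) saddA saddC sadd0 saddN.

Lemma seriesD s t m : (s + t) m = s m + t m. Proof. by []. Qed.

Lemma ssumE (I : Type) (r : seq I) (F : I -> series K n) :
  ssum r F = \sum_(i <- r) F i.
Proof.
apply: boolp.funext => m; rewrite /ssum.
elim: r => [|i r IH]; first by rewrite !big_nil.
by rewrite !big_cons seriesD IH.
Qed.

(** Multiplication by the monomial x^a; [spmul] is a linear combination of such maps, so identities
    are checked on monomials. *)
Definition shift a s : series K n :=
  fun m => if lem a m then s (mnm_sub m a) else 0.

Lemma shiftD a b s : shift (a + b)%MM s = shift a (shift b s).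
Proof.
apply: boolp.funext => m; rewrite /shift.
case: (boolP (a <= m)%MM) => am.
  have -> : (a + b <= m)%MM = (b <= m - a)%MM.
    by apply/mnm_lepP/mnm_lepP => h i; have := h i;
       rewrite mnmDE mnmBE leq_subRL // (mnm_lepP am).
  case: ifP => // _; congr (s _).
  by apply/mnmP => i; rewrite !mnmBE mnmDE subnDA.
case: ifP => // h; case/negP: am; apply: lepm_trans h.
exact: lem_addr.
Qed.

Lemma spmulE p s m : spmul p s m = \sum_(a <- msupp p) p@_a * shift a s m.
Proof.
rewrite /spmul big_mkcond; apply: eq_bigr => a _.
by rewrite /shift; case: ifP => // _; rewrite mulr0.
Qed.

Lemma spmul_widen p (r : seq 'X_{1..n}) s m : uniq r -> {subset msupp p <= r} ->
  spmul p s m = \sum_(a <- r) p@_a * shift a s m.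
Proof.
move=> Ur sub; rewrite spmulE; apply: big_msupp_widen => // a ->.
exact: mul0r.
Qed.

Lemma spmulDl s : {morph (fun p => spmul p s) : p q / p + q}.
Proof.
move=> p q; apply: boolp.funext => m; rewrite seriesD.
pose r := undup (msupp (p + q) ++ msupp p ++ msupp q).
have Ur : uniq r by apply: undup_uniq.
rewrite !(@spmul_widen _ r) // => [|a|a|a]; rewrite ?mem_undup ?mem_cat.
- by rewrite -big_split; apply: eq_bigr => a _ /=; rewrite mcoeffD mulrDl.
- by move=> ->; rewrite !orbT.
- by move=> ->; rewrite !orbT.
- by move=> ->.
Qed.

Lemma spmulDr p : {morph spmul p : s t / s + t}.
Proof.
move=> s t; apply: boolp.funext => m; rewrite seriesD !spmulE -big_split.
apply: eq_bigr => a _ /=; rewrite -mulrDr; congr (_ * _).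
by rewrite /shift; case: ifP => // _; rewrite addr0.
Qed.

Lemma spmulCX (c : K) a s m : spmul (c *: 'X_[a]) s m = c * shift a s m.
Proof.
rewrite (@spmul_widen _ [:: a]) //.
  by rewrite big_seq1 mcoeffZ mcoeffX eqxx mulr1.
by move=> b /msuppZ_le; rewrite msuppX.
Qed.

Lemma spmul1 : left_id 1 (@spmul K n).
Proof.
move=> s; apply: boolp.funext => m.
rewrite -mpolyX0 -(scale1r 'X_[0%MM]) spmulCX mul1r /shift.
have -> : (0 <= m)%MM by apply/mnm_lepP => i; rewrite mnm0E.
by congr (s _); apply/mnmP => i; rewrite mnmBE mnm0E subn0.
Qed.

Lemma spmulA p q s : spmul p (spmul q s) = spmul (p * q) s.
Proof.
elim/mpolyind: p => [|c a p _ _ IH].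
  by rewrite mul0r; apply: boolp.funext => m; rewrite !spmulE msupp0 !big_nil.
rewrite mulrDl !spmulDl {}IH; congr (_ + _).
elim/mpolyind: q => [|d b q _ _ IH].
  rewrite mulr0; apply: boolp.funext => m; rewrite spmulCX /shift.
  by case: ifP => _; rewrite !spmulE !msupp0 !big_nil ?mulr0.
rewrite mulrDr !spmulDl spmulDr {}IH; congr (_ + _).
apply: boolp.funext => m; rewrite -scalerAl -scalerAr scalerA -mpolyXD !spmulCX.
rewrite shiftD -mulrA; congr (_ * _).
by rewrite {1 2}/shift; case: ifP => _; rewrite ?mulr0 // spmulCX.
Qed.

HB.instance Definition _ :=
  GRing.Zmodule_isLmodule.Build {mpoly K[n]} (series K n)
    spmulA spmul1 spmulDr spmulDl.

Lemma spmulEscale p s : spmul p s = p *: s. Proof. by []. Qed.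

(* The product of the lowest terms of [p] and [s] in the monomial order survives. *)
Lemma series_torsion_free p s : p != 0 -> p *: s = 0 -> s = 0.
Proof.
move=> p0 ps0; apply: boolp.funext => m.
elim/(@ltmwf n): m => m IH.
have := congr1 (fun t : series K n => t (mlast p + m)%MM) ps0.
rewrite -spmulEscale spmulE (bigD1_seq (mlast p)) ?mlast_supp ?msupp_uniq //=.
rewrite big_seq_cond big1 ?addr0 => [|a /andP[ap aN]].
  rewrite /shift lem_addr ?lepm_refl // addmC addmK => /eqP.
  rewrite mulf_eq0 => /orP[|/eqP //].
  by rewrite mcoeff_eq0 mlast_supp.
rewrite /shift; case: ifP => [le|]; rewrite ?mulr0 // IH ?mulr0 //.
(* Any other monomial [a] of [p] exceeds the lowest one, so it meets [s] at an index below [m],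
   where the induction hypothesis gives 0. *)
have lt : (mlast p < a)%O by rewrite lt_neqAle eq_sym aN mlast_lemc.
by rewrite -(ltmc_add2r a) [X in (X < _)%O]addmC submK // ltmc_add2l.
Qed.

Lemma smulXE i s : smulX i s = 'X_i *: s.
Proof.
apply: boolp.funext => m; rewrite -spmulEscale -(scale1r 'X_i) spmulCX mul1r.
rewrite /smulX /shift; case: (boolP (0 < m i)%N) => h.
  case: ifP => // /negbT/negP[]; apply/mnm_lepP => j; rewrite mnm1E.
  by case: eqP => // <-.
case: ifP => // /mnm_lepP/(_ i); rewrite mnm1E eqxx => h'; by rewrite h' in h.
Qed.

Lemma sder_comm i j s : sder i (sder j s) = sder j (sder i s).
Proof.
apply: boolp.funext => m; rewrite /sder !mnmDE !mnm1E.
case: (eqVneq i j) => [-> //|_]; rewrite !addn0.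
rewrite !mulrA [_ * (m i).+1%:R]mulrC; congr (_ * s _).
by apply/mnmP => l; rewrite !mnmDE addnAC.
Qed.

Lemma sderD i : {morph sder i : s t / s + t}.
Proof. by move=> s t; apply: boolp.funext => m; apply: mulrDr. Qed.

Lemma sder_shift i a s :
  sder i (shift a s) = ((a i)%:R *: 'X_[a - U_(i)]) *: s + 'X_[a] *: sder i s.
Proof.
apply: boolp.funext => m; rewrite seriesD -!spmulEscale.
rewrite spmulCX -(scale1r 'X_[a]) spmulCX mul1r /sder /shift.
(* If [a i = 0], truncated subtraction makes [a - U_(i)] equal to [a], but the scalar [(a i)%:R]
   removes that term. *)
case: (posnP (a i)) => [a0|a_gt0].
  rewrite a0 mul0r add0r.
  have -> : (a <= m + U_(i))%MM = (a <= m)%MM.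
    apply/mnm_lepP/mnm_lepP => h j; have := h j; rewrite mnmDE mnm1E.
      by case: eqP => [<-|_]; rewrite ?a0 ?addn0.
    by move/leq_trans; apply; apply: leq_addr.
  case: ifP => am; rewrite ?mulr0 // mnmBE a0 subn0; congr (_ * s _).
  by apply/mnmP => j; rewrite !(mnmDE, mnmBE) addnBAC // (mnm_lepP am).
have -> : (a - U_(i) <= m)%MM = (a <= m + U_(i))%MM.
  by apply/mnm_lepP/mnm_lepP => h j; have := h j;
     rewrite mnmDE mnmBE leq_subLR addnC.
have -> : (m - (a - U_(i)) = m + U_(i) - a)%MM.
  apply/mnmP => j; rewrite !(mnmDE, mnmBE) subnBA // mnm1E.
  by case: eqP => // <-.
case: (boolP (a <= m)%MM) => am.
  rewrite (lepm_trans am (lem_addr _ _)) mnmBE.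
  have -> : (m - a + U_(i) = m + U_(i) - a)%MM.
    by apply/mnmP => j; rewrite !(mnmDE, mnmBE) addnBAC // (mnm_lepP am).
  by rewrite -mulrDl -natrD addnS subnKC // (mnm_lepP am).
(* Here [a] divides [m + U_(i)] but not [m], which forces [a i = (m i).+1]: the two integer factors
   agree. *)
rewrite addr0; case: ifP => h; rewrite ?mulr0 //; congr (_%:R * _).
apply/eqP; rewrite eqn_leq; have := mnm_lepP h i; rewrite mnmDE mnm1E eqxx addn1.
move=> ->; rewrite andbT ltnNge; apply: contra am => ai; apply/mnm_lepP => j.
have := mnm_lepP h j; rewrite mnmDE mnm1E.
by case: eqP => [<- //|_]; rewrite addn0.
Qed.

Lemma sderZ i p s : sder i (p *: s) = p^`M(i) *: s + p *: sder i s.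
Proof.
elim/mpolyind: p => [|c a p _ _ IH].
  rewrite mderiv0 !scale0r addr0; apply: boolp.funext => m; exact: mulr0.
rewrite mderivD !scalerDl sderD {}IH addrACA; congr (_ + _).
rewrite mderivZ mderivX.
have E (q : {mpoly K[n]}) t : (c *: q) *: t = c%:MP *: (q *: t).
  by rewrite scalerA mul_mpolyC.
rewrite !E -scalerDr -sder_shift.
have X1 t m : ('X_[a] *: t : series K n) m = shift a t m.
  by rewrite -(scale1r 'X_[a]) -spmulEscale spmulCX mul1r.
have C1 t m : (c%:MP *: t : series K n) m = c * t m.
  rewrite -[c%:MP]mulr1 mul_mpolyC -mpolyX0 -spmulEscale spmulCX /shift.
  have -> : (0 <= m)%MM by apply/mnm_lepP => j; rewrite mnm0E.
  by congr (_ * t _); apply/mnmP => j; rewrite mnmBE mnm0E subn0.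
apply: boolp.funext => m; rewrite C1 /sder C1 X1; exact: mulrCA.
Qed.

End SeriesModule.

(** * Reduction of derivatives modulo the operators, with degree control *)

Section Reduction.
Variables (K : fieldType) (n : nat) (V : lmodType {mpoly K[n]}).
Implicit Types (p q : {mpoly K[n]}) (s t : V) (G : V -> Prop).

(** Only the degrees of the coefficients are bounded, not the number of terms, and [G] is a
    predicate, so generators can be replaced freely during the reduction. *)
Definition spanned G (e : nat) s : Prop :=
  exists2 l : seq ({mpoly K[n]} * V),
    (forall x, x \in l -> (tdeg x.1 <= e)%N /\ G x.2) &
    s = \sum_(x <- l) x.1 *: x.2.

Lemma spanned_gen G e g : G g -> spanned G e g.
Proof.
move=> Gg; exists [:: (1, g)]; last by rewrite big_seq1 scale1r.
by move=> x; rewrite inE => /eqP ->; rewrite tdeg1.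
Qed.

Lemma spanned0 G e : spanned G e 0.
Proof. by exists [::] => //; rewrite big_nil. Qed.

Lemma spannedD G e s t : spanned G e s -> spanned G e t -> spanned G e (s + t).
Proof.
move=> [l1 h1 ->] [l2 h2 ->]; exists (l1 ++ l2); last by rewrite big_cat.
by move=> x; rewrite mem_cat => /orP[/h1|/h2].
Qed.

Lemma spanned_sum (I : eqType) (r : seq I) (F : I -> V) G e :
  (forall i, i \in r -> spanned G e (F i)) -> spanned G e (\sum_(i <- r) F i).
Proof.
move=> h; rewrite big_seq; elim/big_ind: _ => //; first exact: spanned0.
by move=> s t; apply: spannedD.
Qed.

Lemma spannedZ G e e' p s :
  spanned G e s -> (tdeg p <= e')%N -> spanned G (e + e') (p *: s).
Proof.
move=> [l h ->] hp; exists [seq (p * x.1, x.2) | x <- l].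
  move=> _ /mapP[x /h [hx Gx] ->]; split=> //=.
  by rewrite addnC; apply: tdegM_le.
by rewrite big_map scaler_sumr; apply: eq_bigr => x _ /=; rewrite scalerA.
Qed.

Lemma spanned_le G e e' s : (e <= e')%N -> spanned G e s -> spanned G e' s.
Proof.
by move=> le [l h ->]; exists l => // x /h [/leq_trans/(_ le)].
Qed.

Lemma spanned_sub G G' e s :
  (forall g, G g -> G' g) -> spanned G e s -> spanned G' e s.
Proof. by move=> sub [l h ->]; exists l => // x /h [? /sub]. Qed.

Lemma spanned_trans G G' e e' p s : spanned G e s ->
  (forall g, G g -> spanned G' e' (p *: g)) -> spanned G' (e + e') (p *: s).
Proof.
move=> [l h ->] hG; rewrite scaler_sumr; apply: spanned_sum => x /h [hx Gx].
rewrite scalerA mulrC -scalerA addnC; apply: spannedZ => //; exact: hG.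
Qed.

Lemma spanned_expZ G e d k j q s : (tdeg q <= d)%N ->
  spanned G e (q ^+ k *: s) -> spanned G (e + j * d) (q ^+ (k + j) *: s).
Proof.
move=> hq hs; rewrite (addnC k) exprD -scalerA; apply: spannedZ => //.
exact: tdegXn_le.
Qed.

(** Collecting repeated generators only adds coefficients, which does not raise the degree bound; no
    independence of the [h b] is involved. *)
Lemma spanned_coords (T : finType) (h : T -> V) G e s :
  (forall g, G g -> exists b, g = h b) -> spanned G e s ->
  exists2 P : T -> {mpoly K[n]},
    (forall b, tdeg (P b) <= e)%N & s = \sum_b P b *: h b.
Proof.
move=> hG [l hl ->]; elim: l hl => [|x l IH] hl.
  exists (fun=> 0) => [b|]; first by rewrite tdeg0.
  by rewrite big_nil big1 // => b _; rewrite scale0r.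
have [P hP eP] : exists2 P : T -> {mpoly K[n]}, (forall b, tdeg (P b) <= e)%N &
    \sum_(x <- l) x.1 *: x.2 = \sum_b P b *: h b.
  by apply: IH => y yl; apply: hl; rewrite inE yl orbT.
have [hx /hG [b0 eb]] := hl x (mem_head _ _).
exists (fun b => (if b == b0 then x.1 else 0) + P b) => [b|].
  by apply: tdegD_le => //; case: ifP => //; rewrite tdeg0.
rewrite big_cons eP eb.
rewrite [RHS](eq_bigr (fun b => (if b == b0 then x.1 else 0) *: h b + P b *: h b)).
  rewrite big_split /=; congr (_ + _).
  rewrite (bigD1 b0) //= big1; first by rewrite eqxx addr0.
  by move=> b /negPf ->; rewrite scale0r.
by move=> b _; rewrite scalerDl.
Qed.

(** General enough to include the zero map over the zero derivation, which stands in for a third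
    variable when only x_1 and x_2 are differentiated. *)
Definition is_derivation (D : V -> V) (dd : {mpoly K[n]} -> {mpoly K[n]}) :=
  [/\ {morph D : s t / s + t},
      forall p q, dd (p * q) = dd p * q + p * dd q,
      forall p s, D (p *: s) = dd p *: s + p *: D s &
      forall p, (tdeg (dd p) <= tdeg p)%N].

Section OneDerivation.
Variables (D : V -> V) (dd : {mpoly K[n]} -> {mpoly K[n]}).
Hypothesis derD : is_derivation D dd.

Lemma derivation0 : D 0 = 0.
Proof.
case: derD => DD _ _ _; apply: (@addrI _ (D 0)).
by rewrite -DD !addr0.
Qed.

Lemma derivation_sum (I : Type) (r : seq I) (F : I -> V) :
  D (\sum_(i <- r) F i) = \sum_(i <- r) D (F i).
Proof. by case: derD => DD _ _ _; apply: big_morph => //; apply: derivation0. Qed.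

(** The power rule multiplied by [q], which avoids the exponent [k - 1]. *)
Lemma derivationXn q k : q * dd (q ^+ k) = k%:R * dd q * q ^+ k.
Proof.
case: derD => _ DM _ _; elim: k => [|k IH].
  have : dd (1 * 1) = dd 1 + dd 1 by rewrite DM mulr1 mul1r.
  rewrite mulr1 => /(congr1 (fun z => z - dd 1)); rewrite subrr addrK => <-.
  by rewrite mulr0 mul0r mul0r.
rewrite exprS DM mulrDr IH -natr1; ring.
Qed.

Lemma spanned_der G G' e d q s :
  spanned G e s -> (tdeg q <= d)%N -> (forall g, G g -> G' g) ->
  (forall g, G g -> spanned G' d (q *: D g)) -> spanned G' (e + d) (q *: D s).
Proof.
case: derD => _ _ DZ Ddeg [l h ->] hq sub hD.
rewrite derivation_sum scaler_sumr; apply: spanned_sum => x /h [hx Gx].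
rewrite DZ scalerDr; apply: spannedD.
  apply: spannedZ => //; rewrite -[e]add0n; apply: spannedZ.
    by apply: spanned_gen; apply: sub.
  exact: leq_trans hx.
rewrite scalerA mulrC -scalerA addnC; apply: spannedZ => //; exact: hD.
Qed.

(** By the power rule, q^(k+1) D s = q D(q^k s) - k dd(q) (q^k s). Both terms cost at most [d] in
    degree, so a derivative uses one more factor [q] instead of squaring the denominator. *)
Lemma spanned_denom G G' e d q k s :
  spanned G e (q ^+ k *: s) -> (tdeg q <= d)%N -> (forall g, G g -> G' g) ->
  (forall g, G g -> spanned G' d (q *: D g)) ->
  spanned G' (e + d) (q ^+ k.+1 *: D s).
Proof.
case: (derD) => _ _ DZ Ddeg hs hq sub hD.
have -> : q ^+ k.+1 *: D s = q *: D (q ^+ k *: s) - (k%:R * dd q) *: (q ^+ k *: s).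
  by rewrite DZ scalerDr !scalerA derivationXn addrC addKr -exprS.
apply: spannedD; first exact: spanned_der hs _ _ _.
rewrite -scaleNr; apply: spannedZ; first exact: spanned_sub hs.
rewrite tdegN mulr_natl -scaler_nat.
have -> : k%:R *: dd q = (k%:R : K) *: dd q by rewrite !scaler_nat.
by apply: leq_trans (tdegZ_le _ _) _; apply: leq_trans hq.
Qed.

Definition iterates (b : nat) G : V -> Prop :=
  fun g => exists2 j, (j <= b)%N & exists2 g0, G g0 & g = iter j D g0.

(** No rewriting rule for [D] is used: the generators may pick up as many as [b] factors [D], and
    the extra powers of [q] only compensate for differentiating q^k. *)
Lemma spanned_iter G e d q k b s :
  spanned G e (q ^+ k *: s) -> (tdeg q <= d)%N ->
  spanned (iterates b G) (e + b * d) (q ^+ (k + b) *: iter b D s).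
Proof.
move=> hs hq; elim: b => [|b IH].
  rewrite addn0 mul0n addn0; apply: spanned_sub hs => g Gg.
  by exists 0%N => //; exists g.
rewrite addnS mulSn addnCA addnC iterS.
apply: (spanned_denom IH hq) => [g [j jb h]|g [j jb [g0 G0 ->]]].
  by exists j => //; apply: leqW.
rewrite -[d]add0n; apply: spannedZ => //; apply: spanned_gen.
by exists j.+1 => //; exists g0.
Qed.

(** Applying [D] to derivatives of order below [r] creates order at most [r], which one more factor
    [q] brings back below [r]. *)
Lemma spanned_order q d r f (G := fun g => exists2 j, (j < r)%N & g = iter j D f) :
  (tdeg q <= d)%N -> spanned G d (q *: iter r D f) ->
  forall a, spanned G (a.+1 * d) (q ^+ a.+1 *: iter a D f).
Proof.
move=> hq hr.
have hG j : (j <= r)%N -> spanned G d (q *: iter j D f).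
  rewrite leq_eqVlt => /predU1P[-> //|jr].
  by rewrite -[d]add0n; apply: spannedZ => //; apply: spanned_gen; exists j.
elim=> [|a IH]; first by rewrite expr1 mul1n; apply: hG.
rewrite mulSn addnC iterS; apply: (spanned_denom IH hq) => // g [j jr ->].
exact: hG j.+1 jr.
Qed.

End OneDerivation.

(** Reduction in the direction [D3] alone: differentiating the result by [D1] and [D2] never raises
    their exponents above [a] and [b]. Padding to a power [M] independent of a, b, c makes the
    denominator uniform. *)
Lemma spanned_box (D1 D2 D3 : V -> V) d1 d2 d3 q d r f M a b c :
  is_derivation D1 d1 -> is_derivation D2 d2 -> is_derivation D3 d3 ->
  (tdeg q <= d)%N ->
  spanned (fun g => exists2 j, (j < r)%N & g = iter j D3 f) d (q *: iter r D3 f) ->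
  (a + b + c < M)%N ->
  spanned (fun g => exists i j l, [/\ (i <= a)%N, (j <= b)%N, (l < r)%N &
                      g = iter i D1 (iter j D2 (iter l D3 f))])
    (M * d) (q ^+ M *: iter a D1 (iter b D2 (iter c D3 f))).
Proof.
move=> h1 h2 h3 hq hr lt.
have s3 := spanned_order h3 hq hr c.
have s2 := spanned_iter h2 b s3 hq.
have s1 := spanned_iter h1 a s2 hq.
have := spanned_expZ (M - (a + b + c.+1)) hq s1.
have -> : (c.+1 + b + a + (M - (a + b + c.+1)))%N = M by lia.
rewrite -!mulnDl => s; apply: spanned_sub (spanned_le _ s); last first.
  by rewrite leq_mul2r; apply/orP; right; lia.
move=> _ [i ia [_ [j jb [_ [l lr ->] ->]] ->]].
by exists i, j, l.
Qed.

Lemma comm_iter (E F : V -> V) : (forall s, E (F s) = F (E s)) ->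
  forall b s, E (iter b F s) = iter b F (E s).
Proof. by move=> EF b s; elim: b => //= b IH; rewrite EF IH. Qed.

Lemma iter_comm (E F : V -> V) : (forall s, E (F s) = F (E s)) ->
  forall a b s, iter a E (iter b F s) = iter b F (iter a E s).
Proof. by move=> EF a b s; elim: a => //= a ->; rewrite comm_iter. Qed.

Section ThreeDerivations.
Variables (D1 D2 D3 : V -> V) (d1 d2 d3 : {mpoly K[n]} -> {mpoly K[n]}).
Hypotheses (der1 : is_derivation D1 d1) (der2 : is_derivation D2 d2)
  (der3 : is_derivation D3 d3).
Hypotheses (D12 : forall s, D1 (D2 s) = D2 (D1 s))
  (D13 : forall s, D1 (D3 s) = D3 (D1 s)) (D23 : forall s, D2 (D3 s) = D3 (D2 s)).
Variables (f : V) (q1 q2 q3 : {mpoly K[n]}) (r1 r2 r3 d r : nat).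
Hypotheses (hq1 : (tdeg q1 <= d)%N) (hq2 : (tdeg q2 <= d)%N)
  (hq3 : (tdeg q3 <= d)%N).
Hypotheses (hr2 : (r2 <= r.+1)%N) (hr3 : (r3 <= r.+1)%N).
Hypothesis rel1 :
  spanned (fun g => exists2 j, (j < r1)%N & g = iter j D1 f) d (q1 *: iter r1 D1 f).
Hypothesis rel2 :
  spanned (fun g => exists2 j, (j < r2)%N & g = iter j D2 f) d (q2 *: iter r2 D2 f).
Hypothesis rel3 :
  spanned (fun g => exists2 j, (j < r3)%N & g = iter j D3 f) d (q3 *: iter r3 D3 f).

Definition pderiv (a b c : nat) : V := iter a D1 (iter b D2 (iter c D3 f)).

(* Reducing first in [D3], then in [D2], then in [D1] keeps the powers of the *)
(* leading coefficients, hence the degrees, linear in the order [M].          *)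
Lemma spanned_pderiv M e s
    (N := (M + r + r).+1) :
  spanned (fun g => exists a b c, (a + b + c <= M)%N /\ g = pderiv a b c) e s ->
  spanned (fun g => exists a b c,
             [/\ (a < r1)%N, (b < r2)%N, (c < r3)%N & g = pderiv a b c])
    (e + 3 * N * d) ((q1 ^+ N * q2 ^+ N * q3 ^+ N) *: s).
Proof.
move=> hs; rewrite -!scalerA.
have s3 : spanned (fun g => exists a b c,
    [/\ (a + b <= M)%N, (c < r3)%N & g = pderiv a b c]) (e + N * d) (q3 ^+ N *: s).
  apply: spanned_trans hs _ => _ [a [b [c [abc ->]]]].
  have lt : (a + b + c < N)%N by rewrite /N; lia.
  apply: spanned_sub (spanned_box der1 der2 der3 hq3 rel3 lt).
  move=> _ [i [j [l [ia jb lr ->]]]]; exists i, j, l; split=> //; lia.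
have s2 : spanned (fun g => exists a b c,
    [/\ (a <= M)%N, (b < r2)%N, (c < r3)%N & g = pderiv a b c])
    (e + N * d + N * d) (q2 ^+ N *: (q3 ^+ N *: s)).
  apply: spanned_trans s3 _ => _ [a [b [c [ab cr ->]]]].
  have lt : (a + c + b < N)%N by rewrite /N; lia.
  rewrite /pderiv (iter_comm D23).
  apply: spanned_sub (spanned_box der1 der3 der2 hq2 rel2 lt).
  move=> _ [i [l [j [ia lc jr ->]]]]; exists i, j, l; split; try lia.
  by rewrite /pderiv (iter_comm D23).
have -> : (e + 3 * N * d = e + N * d + N * d + N * d)%N by lia.
apply: spanned_trans s2 _ => _ [a [b [c [aM br cr ->]]]].
(* By now [b] and [c] are at most [r] and [a] is at most [M], which explains the choice N = M + 2r +
   1. *)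
have lt : (b + c + a < N)%N by rewrite /N; lia.
rewrite /pderiv (iter_comm D12) (iter_comm D13).
apply: spanned_sub (spanned_box der2 der3 der1 hq1 rel1 lt).
move=> _ [j [l [i [jb lc ir ->]]]]; exists i, j, l; split; try lia.
by rewrite /pderiv (iter_comm D12) (iter_comm D13).
Qed.

End ThreeDerivations.

End Reduction.

(** * Kernel vectors of bounded degree, by Cramer's rule *)

(* [S k] plays the role of "degree at most [k]". *)
Section GradedKernel.
Variables (R : idomainType) (S : nat -> R -> bool).
Hypotheses (S1 : S 0 1) (S0 : forall k, S k 0)
  (SN : forall k x, S k x -> S k (- x))
  (SD : forall k x y, S k x -> S k y -> S k (x + y))
  (SM : forall k l x y, S k x -> S l y -> S (k + l) (x * y))
  (Sle : forall k l x, (k <= l)%N -> S k x -> S l x).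

Lemma graded_sum (I : Type) (r : seq I) (P : pred I) (F : I -> R) k :
  (forall i, P i -> S k (F i)) -> S k (\sum_(i <- r | P i) F i).
Proof. by move=> h; elim/big_ind: _ => // x y; apply: SD. Qed.

Lemma graded_sign k e x : S k x -> S k ((-1) ^+ e * x).
Proof.
move=> Sx; elim: e => [|e IH]; first by rewrite mul1r.
by rewrite exprS -mulrA mulN1r; apply: SN.
Qed.

Lemma graded_prod r (F : 'I_r -> R) k : (forall i, S k (F i)) -> S (r * k) (\prod_i F i).
Proof.
move=> SF; rewrite -{1}[r]card_ord -sum1_card big_distrl /=.
by elim/big_rec2: _ => // i l x _ Sx; rewrite mul1n; apply: SM.
Qed.

Lemma graded_det r (A : 'M[R]_r) k : (forall i j, S k (A i j)) -> S (r * k) (\det A).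
Proof.
move=> SA; rewrite /determinant; apply: graded_sum => s _; apply: graded_sign.
exact: graded_prod.
Qed.

(* A nonvanishing minor of maximal size, bordered by one more column, yields *)
(* a kernel vector made of minors.                                           *)
Lemma graded_kernel p q (A : 'M[R]_(p, q)) k :
  (p < q)%N -> (forall i j, S k (A i j)) ->
  exists x : 'I_q -> R,
    [/\ exists j, x j != 0, forall j, S (p * k) (x j) &
        forall i, \sum_j A i j * x j = 0].
Proof.
move=> pq SA.
(* Row and column selections need not be injective: a repeated row or column just gives a zero
   minor. The empty minor is 1, so a largest size with a nonzero minor exists. *)
pose minors r := [exists f : {ffun 'I_r -> 'I_p}, exists g : {ffun 'I_r -> 'I_q},
  \det (mxsub f g A) != 0].
have ex0 : exists r, minors r.
  exists 0%N; apply/existsP; exists (ffun0 (card_ord 0)).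
  apply/existsP; exists (ffun0 (card_ord 0)).
  by rewrite det_mx00 oner_eq0.
have bd r : minors r -> (r <= p)%N.
  case/existsP => f /existsP [g]; apply: contraNT; rewrite -ltnNge => pr.
  have /injectivePn [i [j ij fij]] : ~~ injectiveb f.
    apply: contraL pr => /injectiveP /leq_card; rewrite !card_ord.
    by rewrite -leqNgt.
  by apply/eqP/(determinant_alternate ij) => l; rewrite !mxE fij.
case: (ex_maxnP ex0 bd) => r /existsP [f /existsP [g nz]] rmax.
have rp : (r <= p)%N by apply: bd; apply/existsP; exists f; apply/existsP; exists g.
have [l0 l0N] : exists l, l \notin codom g.
  apply/existsP; rewrite -negb_forall; apply: contraL pq => /forallP all_g.
  rewrite -leqNgt; apply: leq_trans rp; rewrite -[q]card_ord -[r]card_ord.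
  have <- : #|codom g| = #|'I_q| by apply: eq_card => l; rewrite all_g.
  exact: leq_image_card.
pose g' := [ffun i => if unlift ord_max i is Some j then g j else l0].
pose v (j : 'I_r.+1) := (-1) ^+ (r + j) * \det (mxsub f (g' \o lift j) A).
have g'max : g' ord_max = l0 by rewrite ffunE unlift_none.
have g'lift j : g' (lift ord_max j) = g j by rewrite ffunE liftK.
(* The signed minors [v j] are placed at the columns [g' j]; summing over the fibre avoids proving
   [g'] injective. At the new column [l0] only [ord_max] contributes, leaving the chosen nonzero
   minor. *)
exists (fun l => \sum_(j | g' j == l) v j); split.
- exists l0; rewrite (big_pred1 ord_max) => [|j].
    rewrite /v mulf_eq0 signr_eq0 /=.
    rewrite (_ : mxsub _ _ A = mxsub f g A) //.
    by apply/matrixP => i j; rewrite !mxE /= g'lift.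
  rewrite /= -g'max; case: (unliftP ord_max j) => [j' ->|->]; last by rewrite !eqxx.
  rewrite g'lift g'max [RHS]eq_sym (negPf (neq_lift _ _)).
  by apply: contraNF l0N => /eqP <-; apply: codom_f.
- move=> l; apply: graded_sum => j _; apply: graded_sign.
  apply: (@Sle (r * k)); first by rewrite leq_mul2r rp orbT.
  by apply: graded_det => i j'; rewrite mxE.
- move=> t; pose f' := [ffun i => if unlift ord_max i is Some j then f j else t].
  (* Row [t] is appended to the selected rows; the determinant has size [r.+1], so it vanishes by
     maximality. Its expansion along that row is the required equation. *)
  have : \det (mxsub f' g' A) == 0.
    apply: contraTT (leqnn r.+1) => nz'; rewrite -ltnNge ltnS; apply: rmax.
    by apply/existsP; exists f'; apply/existsP; exists g'.
  rewrite (expand_det_row _ ord_max) => /eqP det0; rewrite -[RHS]det0.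
  rewrite [RHS](partition_big g' predT) //=; apply: eq_bigr => l _.
  rewrite mulr_sumr; apply: eq_bigr => j /eqP gj.
  rewrite mxE gj ffunE unlift_none /cofactor /v; congr (_ * (_ * \det _)).
  by apply/matrixP => i j'; rewrite !mxE ffunE liftK.
Qed.

End GradedKernel.

(** * Linear relations with coefficients in K[x_3..x_n] *)

Section ParameterCoefficients.
Variables (K : fieldType) (m : nat).
Local Notation n := m.+2.
Local Notation ix1 := (ix1 m).
Local Notation ix2 := (ix2 m).
Implicit Types (p q : {mpoly K[n]}) (a : 'X_{1..n}) (k : nat).

Lemma free12P p :
  reflect (forall a, a \in msupp p -> a ix1 = 0%N /\ a ix2 = 0%N) (free12 p).
Proof.
apply: (iffP allP) => h a /h; first by case/andP => /eqP -> /eqP ->.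
by case=> -> ->.
Qed.

(** Joining membership in K[x_3..x_n] to the degree bound lets [graded_kernel] keep its minors in
    the parameter ring while computing in K[x_1..x_n]. *)
Definition param_tdeg k p := free12 p && (tdeg p <= k)%N.

Lemma param_tdegX k a : a ix1 = 0%N -> a ix2 = 0%N -> (mdeg a <= k)%N ->
  param_tdeg k 'X_[a].
Proof.
move=> a1 a2 ak; rewrite /param_tdeg tdegX ak andbT; apply/free12P => b.
by rewrite msuppX inE => /eqP ->.
Qed.

Lemma param_tdeg1 : param_tdeg 0 1.
Proof. by rewrite -mpolyX0; apply: param_tdegX; rewrite ?mnm0E ?mdeg0. Qed.

Lemma param_tdeg0 k : param_tdeg k 0.
Proof. by rewrite /param_tdeg tdeg0 andbT /free12 msupp0. Qed.

Lemma param_tdegN k p : param_tdeg k p -> param_tdeg k (- p).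
Proof.
rewrite /param_tdeg tdegN => /andP[/free12P h ->]; rewrite andbT.
by apply/free12P => a; rewrite (perm_mem (msuppN p)); apply: h.
Qed.

Lemma param_tdegD k p q :
  param_tdeg k p -> param_tdeg k q -> param_tdeg k (p + q).
Proof.
move=> /andP[/free12P hp kp] /andP[/free12P hq kq].
rewrite /param_tdeg tdegD_le // andbT; apply/free12P => a /msuppD_le.
by rewrite mem_cat => /orP[/hp|/hq].
Qed.

Lemma param_tdegM k l p q :
  param_tdeg k p -> param_tdeg l q -> param_tdeg (k + l) (p * q).
Proof.
move=> /andP[/free12P hp kp] /andP[/free12P hq kq].
rewrite /param_tdeg tdegM_le // andbT; apply/free12P => a /msuppM_le.
case/allpairsP => -[b c] /= [/hp [b1 b2] /hq [c1 c2] ->].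
by rewrite !mnmDE b1 b2 c1 c2.
Qed.

Lemma param_tdeg_le k l p : (k <= l)%N -> param_tdeg k p -> param_tdeg l p.
Proof. by move=> kl /andP[fp /leq_trans/(_ kl) lp]; apply/andP. Qed.

Lemma param_tdegZ k (c : K) p : param_tdeg k p -> param_tdeg k (c *: p).
Proof.
move=> /andP[/free12P h kp].
rewrite /param_tdeg (leq_trans (tdegZ_le _ _) kp) andbT.
by apply/free12P => a /msuppZ_le /h.
Qed.

Definition drop12 a : 'X_{1..n} :=
  [multinom if (i == ix1) || (i == ix2) then 0%N else a i | i < n].

Lemma drop12K a : (drop12 a + (U_(ix1) *+ a ix1 + U_(ix2) *+ a ix2))%MM = a.
Proof.
apply/mnmP => i; rewrite !(mnmDE, mulmnE, mnmE).
rewrite ![_ == i]eq_sym; case: (eqVneq i ix1) => [->|_] /=.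
  by rewrite mul1n mul0n addn0.
case: (eqVneq i ix2) => [->|_] /=; first by rewrite mul1n mul0n.
by rewrite addn0.
Qed.

(** The coefficient of x_1^u x_2^v in [p], seen as a polynomial in x_3..x_n. *)
Definition coef12 p (u v : nat) : {mpoly K[n]} :=
  \sum_(a <- msupp p | (a ix1 == u) && (a ix2 == v)) p@_a *: 'X_[drop12 a].

Lemma coef12_param_tdeg k p u v : (tdeg p <= k)%N -> param_tdeg k (coef12 p u v).
Proof.
move=> /tdeg_leP hk; rewrite /coef12 big_seq_cond; elim/big_ind: _ => [||a].
- exact: param_tdeg0.
- by move=> x y; apply: param_tdegD.
move=> /andP[/hk ak _]; apply: param_tdegZ; apply: param_tdegX.
- by rewrite mnmE eqxx.
- by rewrite mnmE eqxx orbT.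
- by apply: leq_trans ak; rewrite -{2}[a]drop12K mdegD leq_addr.
Qed.

Lemma coef12K k p : (tdeg p <= k)%N ->
  p = \sum_(u < k.+1) \sum_(v < k.+1)
        coef12 p u v * ('X_ix1 ^+ u * 'X_ix2 ^+ v).
Proof.
move=> /tdeg_leP hk; rewrite {1}[p]mpolyE.
have lt i a : a \in msupp p -> (a i < k.+1)%N.
  move=> /hk; rewrite ltnS; apply: leq_trans.
  by rewrite mdegE (bigD1 i) //= leq_addr.
transitivity (\sum_(u < k.+1) \sum_(v < k.+1) \sum_(a <- msupp p)
    if (a ix1 == u) && (a ix2 == v) then p@_a *: 'X_[a] else 0); last first.
  apply: eq_bigr => u _; apply: eq_bigr => v _.
  rewrite /coef12 mulr_suml [RHS]big_mkcond /=; apply: eq_bigr => a _.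
  case: ifP => // /andP[/eqP <- /eqP <-].
  by rewrite -scalerAl !mpolyXn -!mpolyXD drop12K.
under [RHS]eq_bigr => u _ do rewrite exchange_big /=.
rewrite [RHS]exchange_big /= big_seq [RHS]big_seq; apply: eq_bigr => a ap.
rewrite (bigD1 (Ordinal (lt ix1 a ap))) //= (bigD1 (Ordinal (lt ix2 a ap))) //=.
rewrite !eqxx /= !big1 ?addr0 // => [u uN|v vN].
  rewrite big1 // => v _; case: ifP => // /andP[/eqP au _].
  by case/eqP: uN; apply: val_inj.
by case: ifP => // /eqP av; case/eqP: vN; apply: val_inj.
Qed.

(** As the unknowns are free of x_1 and x_2, each equation splits into at most (k+1)^2 equations,
    one for each x_1^u x_2^v. With more unknowns than equations, [graded_kernel] applies. *)
Lemma param_relation (J B : finType) (P : J -> B -> {mpoly K[n]}) k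
    (N := (#|B| * k.+1 ^ 2)%N) :
  (forall j b, tdeg (P j b) <= k)%N -> (N < #|J|)%N ->
  exists v : J -> {mpoly K[n]},
    [/\ exists j, v j != 0, forall j, param_tdeg (N * k) (v j) &
        forall b, \sum_j v j * P j b = 0].
Proof.
move=> hP; pose E : finType := (B * ('I_k.+1 * 'I_k.+1))%type.
have -> : N = #|{: E}| by rewrite !card_prod !card_ord.
move=> lt.
pose A : 'M[{mpoly K[n]}]_(#|{: E}|, #|J|) := \matrix_(i, j)
  (let e : E := enum_val i in coef12 (P (enum_val j) e.1) e.2.1 e.2.2).
have [||||||i j|x [[j0 nz] xdeg x0]] :=
    @graded_kernel _ param_tdeg _ _ _ _ _ _ _ _ A k lt.
- exact: param_tdeg1.
- exact: param_tdeg0.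
- exact: param_tdegN.
- exact: param_tdegD.
- exact: param_tdegM.
- exact: param_tdeg_le.
- by rewrite mxE; apply: coef12_param_tdeg.
exists (fun j => x (enum_rank j)); split.
- by exists (enum_val j0); rewrite enum_valK.
- by move=> j; apply: xdeg.
move=> b; under eq_bigr => j _ do
  rewrite {1}(coef12K (hP j b)) pair_big mulr_sumr /=.
rewrite exchange_big big1 //= => -[u v] _ /=.
have := x0 (enum_rank ((b, (u, v)) : E)) => /(congr1 (fun z => z * ('X_ix1 ^+ u * 'X_ix2 ^+ v))).
rewrite mul0r mulr_suml => h0; rewrite -[RHS]h0 [RHS](reindex (@enum_rank J)) /=; last exact: onW_bij (@enum_rank_bij J).
apply: eq_bigr => j _; rewrite mxE !enum_rankK /=; ring.
Qed.

End ParameterCoefficients.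

(** * The derivations on series and the rewriting rules given by the operators *)

Section SeriesDerivations.
Variables (K : fieldType) (n : nat).

Lemma sder_derivation (i : 'I_n) : @is_derivation K n (series K n) (sder i) (mderiv i).
Proof.
split; [exact: sderD|exact: mderivM|exact: sderZ|exact: tdeg_mderiv].
Qed.

Lemma zero_derivation (V : lmodType {mpoly K[n]}) :
  @is_derivation K n V (fun=> 0) (fun=> 0).
Proof.
split=> [s t|p q|p s|p]; first by rewrite addr0.
- by rewrite mul0r mulr0 addr0.
- by rewrite scale0r scaler0 addr0.
- by rewrite tdeg0.
Qed.

(** Solving L(f) = 0 for its top derivative gives the rewriting rule, with the leading coefficient
    as denominator. *)
Lemma ordop_relation (i : 'I_n) (L : {poly {mpoly K[n]}}) (f : series K n) d :
  L != 0 -> ordop i L f = szero K n -> (op_degree L <= d)%N ->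
  (tdeg (lead_coef L) <= d)%N /\
  spanned (fun g => exists2 j, (j < op_order L)%N & g = iter j (sder i) f) d
    (lead_coef L *: iter (op_order L) (sder i) f).
Proof.
move=> L0 Lf /bigmax_leqP Ld.
have sL : size L = (op_order L).+1 by rewrite /op_order prednK // lt0n size_poly_eq0.
have Ldeg j : (j < size L)%N -> (tdeg L`_j <= d)%N by move=> jL; apply: (Ld (Ordinal jL)).
split; first by apply: Ldeg; rewrite sL.
have : \sum_(j <- iota 0 (size L)) L`_j *: iter j (sder i) f = 0.
  by rewrite -ssumE; apply: Lf.
rewrite sL -addn1 iotaD add0n big_cat big_seq1 /= => /eqP.
rewrite addrC addr_eq0 => /eqP ->; rewrite -sumrN.
apply: spanned_sum => j; rewrite mem_iota add0n => jr.
rewrite -scaleNr -[d]add0n; apply: spannedZ.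
  by apply: spanned_gen; exists j.
by rewrite tdegN; apply: Ldeg; rewrite sL ltnW.
Qed.

End SeriesDerivations.

(** * Words in T and E applied to [f], and the count of unknowns against equations *)

Section Words.
Variables (K : fieldType) (m : nat).
Local Notation n := m.+2.
Local Notation ix1 := (ix1 m).
Local Notation ix2 := (ix2 m).
Variables (f : series K n) (D3 : series K n -> series K n)
  (d3 : {mpoly K[n]} -> {mpoly K[n]}).
Hypotheses (der3 : is_derivation D3 d3)
  (D3_comm : forall i s, sder i (D3 s) = D3 (sder i s)).

Definition derivs_upto (M : nat) (g : series K n) : Prop :=
  exists a b c, (a + b + c <= M)%N /\ g = pderiv (sder ix1) (sder ix2) D3 f a b c.

Lemma derivs_upto_le M M' g : (M <= M')%N -> derivs_upto M g -> derivs_upto M' g.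
Proof.
move=> le [a [b [c [abc ->]]]]; exists a, b, c; split=> //.
exact: leq_trans le.
Qed.

Lemma spanned_derivs_der D dd M e s : is_derivation D dd ->
  (forall g, derivs_upto M g -> derivs_upto M.+1 (D g)) ->
  spanned (derivs_upto M) e s -> spanned (derivs_upto M.+1) e (D s).
Proof.
move=> derD hD hs; rewrite -[D s]scale1r -[e]addn0.
apply: (spanned_der derD hs) => [|g|g /hD hg]; first by rewrite tdeg1.
  exact: derivs_upto_le.
by rewrite scale1r; apply: spanned_gen.
Qed.

Lemma spanned_derivs1 M e s : spanned (derivs_upto M) e s ->
  spanned (derivs_upto M.+1) e (sder ix1 s).
Proof.
apply: spanned_derivs_der (sder_derivation _ _) _ => _ [a [b [c [abc ->]]]].
by exists a.+1, b, c.
Qed.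

Lemma spanned_derivs2 M e s : spanned (derivs_upto M) e s ->
  spanned (derivs_upto M.+1) e (sder ix2 s).
Proof.
apply: spanned_derivs_der (sder_derivation _ _) _ => _ [a [b [c [abc ->]]]].
exists a, b.+1, c; split; first by rewrite addnS.
by rewrite /pderiv (comm_iter (@sder_comm K n ix2 ix1)).
Qed.

Lemma spanned_derivs3 M e s : spanned (derivs_upto M) e s ->
  spanned (derivs_upto M.+1) e (D3 s).
Proof.
apply: spanned_derivs_der der3 _ => _ [a [b [c [abc ->]]]].
exists a, b, c.+1; split; first by rewrite addnS.
have E i t : D3 (sder i t) = sder i (D3 t) by [].
by rewrite /pderiv (comm_iter (E ix1)) (comm_iter (E ix2)).
Qed.

Lemma spanned_derivs_sT M e s : spanned (derivs_upto M) e s ->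
  spanned (derivs_upto M.+1) e.+1 (sT s).
Proof.
move=> hs; have -> : sT s = 'X_ix1 *: sder ix1 s + (- 'X_ix2) *: sder ix2 s.
  by rewrite scaleNr -!smulXE.
rewrite -(addn1 e); apply: spannedD; apply: spannedZ.
- exact: spanned_derivs1.
- by rewrite tdegX mdeg1.
- exact: spanned_derivs2.
- by rewrite tdegN tdegX mdeg1.
Qed.

Variable E : series K n -> series K n.
Hypothesis spanned_derivs_E : forall M e s, spanned (derivs_upto M) e s ->
  spanned (derivs_upto M.+2) e (E s).

(** Each [sT] adds one to the order and one to the degree; each [E] adds no degree and at most two
    to the order, enough for [sD12] as well as for [sder h]. *)
Lemma spanned_word j l :
  spanned (derivs_upto (j + l.*2)) j (iter j (@sT K m) (iter l E f)).
Proof.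
elim: j => [|j IH]; last exact: spanned_derivs_sT IH.
elim: l => [|l IH]; last exact: spanned_derivs_E IH.
by apply: spanned_gen; exists 0%N, 0%N, 0%N.
Qed.

Variables (q1 q2 q3 : {mpoly K[n]}) (r1 r2 r3 d r : nat).
Hypotheses (q1_neq0 : q1 != 0) (q2_neq0 : q2 != 0) (q3_neq0 : q3 != 0).
Hypotheses (hq1 : (tdeg q1 <= d)%N) (hq2 : (tdeg q2 <= d)%N)
  (hq3 : (tdeg q3 <= d)%N).
Hypotheses (hr2 : (r2 <= r.+1)%N) (hr3 : (r3 <= r.+1)%N).
Hypothesis rel1 : spanned (fun g => exists2 j, (j < r1)%N & g = iter j (sder ix1) f) d
  (q1 *: iter r1 (sder ix1) f).
Hypothesis rel2 : spanned (fun g => exists2 j, (j < r2)%N & g = iter j (sder ix2) f) d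
  (q2 *: iter r2 (sder ix2) f).
Hypothesis rel3 : spanned (fun g => exists2 j, (j < r3)%N & g = iter j D3 f) d
  (q3 *: iter r3 D3 f).

(** All words with exponents below [N] have order at most 3N, so the same powers of the three
    leading coefficients clear every denominator. *)
Lemma word_coords N : exists2 Q : {mpoly K[n]}, Q != 0 &
  exists h : 'I_r1 * 'I_r2 * 'I_r3 -> series K n,
  exists2 P : 'I_N * 'I_N -> 'I_r1 * 'I_r2 * 'I_r3 -> {mpoly K[n]},
    (forall w b, tdeg (P w b) <= N + 3 * (3 * N + r + r).+1 * d)%N &
    forall w : 'I_N * 'I_N,
      Q *: iter w.1 (@sT K m) (iter w.2 E f) = \sum_b P w b *: h b.
Proof.
set M := (3 * N + r + r).+1; exists (q1 ^+ M * q2 ^+ M * q3 ^+ M).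
  by rewrite !mulf_neq0 // expf_neq0.
pose h (b : 'I_r1 * 'I_r2 * 'I_r3) :=
  pderiv (sder ix1) (sder ix2) D3 f b.1.1 b.1.2 b.2.
exists h.
suff /fin_all_exists2[P hP PE] : forall w : 'I_N * 'I_N,
    exists2 P : 'I_r1 * 'I_r2 * 'I_r3 -> {mpoly K[n]},
    (forall b, tdeg (P b) <= N + 3 * M * d)%N &
    (q1 ^+ M * q2 ^+ M * q3 ^+ M) *: iter w.1 (@sT K m) (iter w.2 E f)
      = \sum_b P b *: h b.
  by exists P.
case=> j l /=.
have D12 s := @sder_comm K n ix1 ix2 s.
have hw : spanned (derivs_upto (3 * N)) N (iter j (@sT K m) (iter l E f)).
  apply: spanned_le (ltnW (ltn_ord j)) _.
  apply: spanned_sub (spanned_word j l) => g; apply: derivs_upto_le.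
  by have := ltn_ord j; have := ltn_ord l; lia.
have := spanned_pderiv (sder_derivation _ _) (sder_derivation _ _) der3 D12
  (D3_comm ix1) (D3_comm ix2) hq1 hq2 hq3 hr2 hr3 rel1 rel2 rel3 hw.
apply: spanned_coords => _ [a [b [c [ha hb hc ->]]]].
by exists (Ordinal ha, Ordinal hb, Ordinal hc).
Qed.

Definition mnm3 (i j l : nat) : 'X_{1..3} :=
  [multinom if t == e0 then i else if t == e1 then j else l | t < 3].

Lemma mnm3E i j l : [/\ mnm3 i j l e0 = i, mnm3 i j l e1 = j & mnm3 i j l e2 = l].
Proof. by rewrite !mnmE /e0 /e1 /e2 -!(inj_eq val_inj) /= !inordK. Qed.

Lemma iter_smulX1X2 i (s : series K n) :
  iter i (fun t => smulX ix1 (smulX ix2 t)) s = ('X_ix1 * 'X_ix2) ^+ i *: s.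
Proof.
elim: i => [|i IH]; first by rewrite scale1r.
by rewrite iterS IH !smulXE !scalerA exprS.
Qed.

(** [R] bounds the number of basis derivatives and is later (r_f+1)^2 or (r_f+1)^3. The bound on
    [c0] exceeds the 18^2 needed for the count; the factor 17 serves the parameter degree. *)
Lemma annihilator (R c0 : nat) : (r1 * r2 * r3 <= R)%N -> (r < R)%N ->
  (18 * 18 * 17 <= c0)%N ->
  exists c : {mpoly {mpoly K[n]}[3]},
    [/\ c != 0 /\ subalg_coeffs c,
        subalg_act E c f = szero K n,
        (deg_x1x2 c <= c0 ^ 4 * d.+1 ^ 2 * R)%N,
        (deg_params c <= c0 ^ 4 * d.+1 ^ 6 * R ^ 4)%N &
        (deg_ops c <= c0 ^ 4 * d.+1 ^ 2 * R)%N].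
Proof.
(* There are (d+1) N^3 = c0 R (N (d+1))^2 unknowns, against at most 18^2 R (N (d+1))^2 equations.
   Allowing [d.+1] times more powers of x_1 x_2 costs only the degree that the reduction already
   has. *)
move=> hR rR hc0; pose N := (c0 * R * d.+1)%N; pose N1 := (d.+1 * N)%N.
have [Q Q0 [h [P Pdeg PE]]] := word_coords N.
pose J : finType := ('I_N1 * ('I_N * 'I_N))%type; pose B : finType := ('I_r1 * 'I_r2 * 'I_r3)%type.
(* The powers of x_1 x_2 contribute at most 2N(d+1) and the word coordinates at most N + 15Nd, since
   r < N. *)
pose k := (17 * N * d.+1)%N.
have R_gt0 : (0 < R)%N by apply: leq_ltn_trans rR.
have c0_gt0 : (0 < c0)%N by apply: leq_trans hc0.
have N_gt0 : (0 < N)%N by rewrite !muln_gt0 c0_gt0 R_gt0.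
have RN : (R <= N)%N by rewrite /N mulnAC leq_pmull // muln_gt0 c0_gt0.
pose PJ (x : J) (b : B) := ('X_ix1 * 'X_ix2) ^+ x.1 * P x.2 b.
have PJdeg x b : (tdeg (PJ x b) <= k)%N.
  have le : (x.1 * 2 + (N + 3 * (3 * N + r + r).+1 * d) <= k)%N.
    have := ltn_ord x.1; have : (r < N)%N by apply: leq_trans rR RN.
    rewrite /k /N1; move: (x.1 : nat) => i; clearbody N; nia.
  apply: leq_trans le; apply: tdegM_le => //; apply: tdegXn_le.
  by apply: (@tdegM_le _ _ _ _ 1 1); rewrite tdegX mdeg1.
have cardB : #|{: B}| = (r1 * r2 * r3)%N by rewrite !card_prod !card_ord.
have cardJ : #|{: J}| = (N1 * (N * N))%N by rewrite !card_prod !card_ord.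
have eqs : (#|{: B}| * k.+1 ^ 2 <= R * (18 * N * d.+1) ^ 2)%N.
  rewrite cardB leq_mul // leq_exp2r // /k.
  by move: N N_gt0 {N1 RN P Pdeg PE J k PJ PJdeg cardJ} => N; nia.
have lt : (#|{: B}| * k.+1 ^ 2 < #|{: J}|)%N.
  apply: leq_ltn_trans eqs _; rewrite cardJ.
  have -> : (N1 * (N * N) = c0 * (R * (N * d.+1) ^ 2))%N by rewrite /N1 {1}/N; ring.
  have -> : (R * (18 * N * d.+1) ^ 2 = 18 * 18 * (R * (N * d.+1) ^ 2))%N by ring.
  rewrite ltn_pmul2r; first by apply: leq_trans hc0.
  by rewrite muln_gt0 R_gt0 expn_gt0 muln_gt0 N_gt0.
have [v [[x0 vx0] vdeg vP]] := param_relation PJdeg lt.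
pose mk (x : J) := mnm3 x.1 x.2.1 x.2.2.
have mk_inj : injective mk.
  move=> [i [j l]] [i' [j' l']]; rewrite /mk /= => e.
  have [i1 j1 l1] := mnm3E i j l; have [i2 j2 l2] := mnm3E i' j' l'.
  have ei : i = i' by apply: val_inj; rewrite /= -i1 e i2.
  have ej : j = j' by apply: val_inj; rewrite /= -j1 e j2.
  have el : l = l' by apply: val_inj; rewrite /= -l1 e l2.
  by rewrite ei ej el.
pose c : {mpoly {mpoly K[n]}[3]} := \sum_x v x *: 'X_[mk x].
have cE x : c@_(mk x) = v x.
  rewrite /c raddf_sum /= (bigD1 x) //= mcoeffZ mcoeffX eqxx mulr1 big1 ?addr0 //.
  by move=> y yx; rewrite mcoeffZ mcoeffX (inj_eq mk_inj) (negPf yx) mulr0.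
have csupp e : e \in msupp c -> exists x, e = mk x.
  rewrite mcoeff_msupp => nz; apply/exists_eqP; apply: contraNT nz.
  rewrite negb_exists => /forallP ne; rewrite /c raddf_sum /= big1 // => x _.
  by rewrite mcoeffZ mcoeffX eq_sym (negPf (ne x)) mulr0.
have C4 : (c0 <= c0 ^ 4)%N by rewrite -{1}[c0]expn1 leq_pexp2l.
exists c; split.
- split.
    by apply: contraNneq vx0 => c_eq0; rewrite -cE c_eq0 mcoeff0.
  apply/allP => _ /csupp [x ->]; rewrite cE.
  by case/andP: (vdeg x).
(* It suffices to annihilate after multiplying by [Q], where the coordinates of the words are
   polynomials. The sum is then widened to all of [J], as some [v x] may be zero. *)
- apply: (series_torsion_free Q0); rewrite /subalg_act ssumE.
  rewrite (@big_msupp_widen _ _ _ _ [seq mk x | x <- enum J]); first last.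
  + by move=> a ->; rewrite iter_smulX1X2 spmulEscale scale0r scaler0.
  + by move=> a /csupp [x ->]; rewrite map_f // mem_enum.
  + by rewrite map_inj_uniq // enum_uniq.
  rewrite big_map big_enum /= scaler_sumr.
  have scaleQ a b (s : series K n) : Q *: (a *: (b *: s)) = (b * a) *: (Q *: s).
    by rewrite !scalerA; congr (_ *: _); ring.
  under eq_bigr => x _.
    rewrite iter_smulX1X2 spmulEscale cE /mk.
    have [-> -> ->] := mnm3E x.1 x.2.1 x.2.2.
    rewrite scaleQ PE scaler_sumr.
    over.
  rewrite exchange_big big1 //= => b _.
  under eq_bigr => x _ do rewrite scalerA -mulrA.
  by rewrite -scaler_suml [X in X *: _](vP b) scale0r.
- apply/bigmax_leqP_seq => _ /csupp [x ->] _.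
  have [-> _ _] := mnm3E x.1 x.2.1 x.2.2.
  apply: leq_trans (ltnW (ltn_ord x.1)) _; rewrite /N1 /N.
  have -> : (d.+1 * (c0 * R * d.+1) = c0 * (d.+1 ^ 2 * R))%N by ring.
  by rewrite -mulnA leq_mul2r C4 orbT.
- apply/bigmax_leqP_seq => _ /csupp [x ->] _; rewrite cE.
  have /andP[_ vx] := vdeg x; apply: leq_trans vx _.
  apply: leq_trans (leq_mul eqs (leqnn _)) _; rewrite /k.
  (* The kernel bound is (number of equations) times [k]; inserting N = c0 R (d+1) gives (d+1)^6
     R^4, and one factor [c0] absorbs 18*18*17. *)
  have -> : (R * (18 * N * d.+1) ^ 2 * (17 * N * d.+1) =
    18 * 18 * 17 * (c0 ^ 3 * d.+1 ^ 6 * R ^ 4))%N by rewrite /N; ring.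
  have -> : (c0 ^ 4 * d.+1 ^ 6 * R ^ 4 = c0 * (c0 ^ 3 * d.+1 ^ 6 * R ^ 4))%N.
    by rewrite (expnS c0 3) !mulnA.
  by rewrite leq_mul2r hc0 orbT.
- apply/bigmax_leqP_seq => _ /csupp [x ->] _.
  have [_ -> ->] := mnm3E x.1 x.2.1 x.2.2.
  apply: leq_trans (leq_add (ltnW (ltn_ord _)) (ltnW (ltn_ord _))) _.
  have -> : (N + N = 2 * c0 * (d.+1 * R))%N by rewrite /N; ring.
  rewrite -[leqRHS]mulnA leq_mul //; last first.
    by rewrite leq_mul2r -{1}[d.+1]expn1 leq_pexp2l ?orbT.
  rewrite mulnC (expnS c0 3) leq_mul2l; apply/orP; right.
  apply: leq_trans (_ : c0 <= _)%N; first exact: leq_trans hc0.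
  by rewrite -{1}[c0]expn1 leq_pexp2l.
Qed.

End Words.

(** * The two families of annihilators *)

Theorem theorem3p16 :
  exists C : nat,
  forall (K : fieldType) (m : nat), [pchar K] =i pred0 ->
  forall f : series K m.+2, DFinite f ->
  forall L : 'I_m.+2 -> {poly {mpoly K[m.+2]}},
    (forall i, L i != 0) ->
    (forall i, ordop i (L i) f = szero K m.+2) ->
    let rf := (\max_(i < m.+2) op_order (L i))%N in
    let df := (\max_(i < m.+2) op_degree (L i))%N in
    (exists c : {mpoly {mpoly K[m.+2]}[3]},
       [/\ c != 0 /\ subalg_coeffs c,
           subalg_act (@sD12 K m) c f = szero K m.+2,
           (deg_x1x2 c <= C * (df + 1) ^ 2 * (rf + 1) ^ 2)%N,
           (deg_params c <= C * (df + 1) ^ 9 * (rf + 1) ^ 8)%N &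
           (deg_ops c <= C * (df + 1) ^ 2 * (rf + 1) ^ 2)%N])
    /\
    (forall h : 'I_m.+2, (2 <= h)%N ->
     exists c : {mpoly {mpoly K[m.+2]}[3]},
       [/\ c != 0 /\ subalg_coeffs c,
           subalg_act (sder h) c f = szero K m.+2,
           (deg_x1x2 c <= C * (df + 1) ^ 2 * (rf + 1) ^ 3)%N,
           (deg_params c <= C * (df + 1) ^ 9 * (rf + 1) ^ 12)%N &
           (deg_ops c <= C * (df + 1) ^ 2 * (rf + 1) ^ 3)%N]).
Proof.
(* Hiding the numeral behind a variable keeps its fourth power from being computed in unary. *)
have [c0 hc0] : exists c0, (18 * 18 * 17 <= c0)%N by exists (18 * 18 * 17)%N.
exists (c0 ^ 4)%N => K m _ f _ L L0 Lf rf df.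
have ordL i : (op_order (L i) <= rf)%N by apply: leq_bigmax.
have relL i := ordop_relation (L0 i) (Lf i) (leq_bigmax i : _ <= df)%N.
have lcL i : lead_coef (L i) != 0 by rewrite lead_coef_eq0.
(* The argument gives exponent 6 in the degree; it is relaxed to the stated 9. *)
have params e : (c0 ^ 4 * (df + 1) ^ 6 * e <= c0 ^ 4 * (df + 1) ^ 9 * e)%N.
  by rewrite leq_mul2r leq_mul2l leq_pexp2l ?orbT // addn1.
have rf_lt e : (rf < (rf + 1) ^ e.+1)%N.
  by rewrite addn1 -{1}[rf.+1]expn1 leq_pexp2l.
have [deg1 rel1] := relL (ix1 m); have [deg2 rel2] := relL (ix2 m).
have ord2 : (op_order (L (ix2 m)) <= rf.+1)%N by apply: leqW.
split=> [|h _].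
(* With [D3 = 0], annihilated in order 1, the box of derivatives is planar. *)
- have comm0 i (s : series K m.+2) : sder i 0 = 0 :> series K m.+2.
    exact: derivation0 (sder_derivation K i).
  have hE M e s : spanned (derivs_upto f (fun=> 0) M) e s ->
      spanned (derivs_upto f (fun=> 0) M.+2) e (@sD12 K m s).
    by move=> hs; apply/spanned_derivs1/spanned_derivs2.
  have rel3 : spanned (fun g => exists2 j, (j < 1)%N & g = iter j (fun=> 0) f) df
      (1 *: iter 1 (fun=> 0) f : series K m.+2).
    by rewrite /= scaler0; apply: spanned0.
  have hR : (op_order (L (ix1 m)) * op_order (L (ix2 m)) * 1 <= (rf + 1) ^ 2)%N.
    by rewrite muln1 expnS expn1 addn1 leq_mul // leqW.
  have deg3 : (tdeg (1 : {mpoly K[m.+2]}) <= df)%N by rewrite tdeg1.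
  have [c [c_ok c_act cx cp co]] := annihilator (zero_derivation _) comm0 hE
    (lcL _) (lcL _) (oner_neq0 _) deg1 deg2 deg3 ord2 (ltn0Sn rf) rel1 rel2 rel3
    hR (rf_lt 1%N) hc0.
  exists c; split=> //; try by rewrite addn1.
  by apply: leq_trans (params _); rewrite (expnM _ 2 4) !addn1 in cp *.
- have hE M e s : spanned (derivs_upto f (sder h) M) e s ->
      spanned (derivs_upto f (sder h) M.+2) e (sder h s).
    move=> /(spanned_derivs3 (sder_derivation K h) (@sder_comm _ _ ^~ h)).
    by apply: spanned_sub => g; apply: derivs_upto_le.
  have [deg3 rel3] := relL h.
  have hR : (op_order (L (ix1 m)) * op_order (L (ix2 m)) * op_order (L h)
      <= (rf + 1) ^ 3)%N.
    by rewrite 2!expnSr expn1 addn1 !leq_mul // leqW.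
  have [c [c_ok c_act cx cp co]] := annihilator (sder_derivation K h)
    (@sder_comm _ _ ^~ h) hE (lcL _) (lcL _) (lcL _) deg1 deg2 deg3 ord2
    (leqW (ordL h)) rel1 rel2 rel3 hR (rf_lt 2%N) hc0.
  exists c; split=> //; try by rewrite addn1.
  by apply: leq_trans (params _); rewrite (expnM _ 3 4) !addn1 in cp *.
Qed.
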